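(* Let $\mathbb{F}$ be a complete normed field, let $d\ge1$, and let $X\subseteq\mathbb{F}^d$ be spread. There is a constant $C>0$ depending only on $X$ such that for every $X$-hyperbolic polynomial $p$ on $\mathbb{F}^d$ with zero set $Z=\{w\in\mathbb{F}^d : p(w)=0\}$ and every $u\in\mathbb{F}^d$, $$d(u,Z)\ \ge\ C\,\inf_{x\in X}\ \sup\{\,r : p(u+zx)\neq0\ \text{for all } z\in\mathbb{F} \text{ with } |z|\le r\,\}.$$
   Context: A norm on a field $\mathbb{F}$ is a function $|\cdot|:\mathbb{F}\to[0,\infty)$ with $|x|=0$ iff $x=0$, $|xy|=|x||y|$, and $|x+y|\le|x|+|y|$; $\mathbb{F}$ is complete if it is complete for the metric $d(x,y)=|x-y|$. On $\mathbb{F}^d$ distances are measured by the max norm, $d(u,Z)=\inf_{w\in Z}\max_i|u_i-w_i|$ ($=\infty$ if $Z=\emptyset$). In the supremum $r$ ranges over nonnegative reals, and the supremum of the empty set is $0$. A polynomial $p$ in $d$ variables over $\mathbb{F}$ is $X$-hyperbolic if for every $u\in\mathbb{F}^d$ and every $x\in X$ the one-variable polynomial $p(u+zx)$ in $z$ is $\mathbb{F}$-rooted, i.e. all of its roots lie in $\mathbb{F}$ (it splits over $\mathbb{F}$). The Cantor space $2^{\aleph_0}$ is the set of infinite $0$-$1$ sequences (branches of the binary tree of finite bitstrings), with the metric in which the distance between two distinct branches $a,b$ is $2^{-n}$, where $n$ is the depth to which $a$ and $b$ agree. Its natural measure assigns measure $2^{-n}$ to the set of branches extending a given bitstring of length $n$;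 powers of $2^{\aleph_0}$ carry the product measure. An embedding $\iota:2^{\aleph_0}\to\mathbb{F}$ is spread if there are $C',\gamma>0$ with $d(\iota(x),\iota(y))\ge C'\,d(x,y)^\gamma$ for all $x,y$. A set $Y\subseteq\mathbb{F}^k$ is affine-spread if there are spread embeddings $\iota_1,\dots,\iota_k:2^{\aleph_0}\to\mathbb{F}$ such that, for $\iota=\iota_1\times\dots\times\iota_k$, the set $\iota^{-1}(Y)$ has positive outer measure with respect to the natural measure on $(2^{\aleph_0})^k$. A set $X\subseteq\mathbb{F}^d$ is spread if $$\tilde X=\{(x_2/x_1,\dots,x_d/x_1) : (x_1,\dots,x_d)\in X,\ x_1\ne0\}\subseteq\mathbb{F}^{d-1}$$ is affine-spread. *)

(* Defs.v *)
From HB Require Import structures.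
From mathcomp Require Import all_boot all_order all_algebra.
From mathcomp Require Import all_classical all_reals all_analysis.
(* Not imported: its notations clash with those of the analysis library. *)
From mathcomp Require mpoly.

Set Implicit Arguments.
Unset Strict Implicit.
Unset Printing Implicit Defensive.

Import Order.TTheory GRing.Theory Num.Theory.

Local Open Scope classical_set_scope.
Local Open Scope ring_scope.

Section normed_field.
Context {R : realType} {F : fieldType}.

Record is_norm (N : F -> R) : Prop := IsNorm {
  norm_ge0 : forall x, 0 <= N x;
  norm_eq0 : forall x, N x = 0 <-> x = 0;
  normM : forall x y, N (x * y) = N x * N y;
  normD : forall x y, N (x + y) <= N x + N y }.

Definition is_complete (N : F -> R) : Prop :=
  forall s : nat -> F,
    (forall e : R, 0 < e ->
      exists n0, forall m n, (n0 <= m)%N -> (n0 <= n)%N -> N (s m - s n) < e) ->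
    exists l : F, forall e : R, 0 < e ->
      exists n0, forall n, (n0 <= n)%N -> N (s n - l) < e.

Definition max_norm (N : F -> R) n (v : 'rV[F]_n) : R :=
  \big[Num.max/0]_(i < n) N (v 0 i).

Definition dist_set (N : F -> R) n (u : 'rV[F]_n) (Z : set 'rV[F]_n) : \bar R :=
  ereal_inf [set (max_norm N (u - w))%:E | w in Z].

End normed_field.

Section hyperbolic.
Context {F : fieldType} {n : nat}.
Implicit Types (p : mpoly.mpoly n F) (u x : 'rV[F]_n).

Definition peval p u : F := mpoly.meval (fun i => u 0 i) p.

Definition zero_set p : set 'rV[F]_n := [set w | peval p w = 0].

(* p(u + zx) as a polynomial in the variable z *)
Definition line_poly p u x : {poly F} :=
  mpoly.mmap polyC (fun i => (u 0 i)%:P + x 0 i *: 'X) p.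

(* The zero polynomial counts as splitting (take c = 0). *)
Definition splits (q : {poly F}) : Prop :=
  exists (c : F) (rs : seq F), q = c *: \prod_(a <- rs) ('X - a%:P).

Definition hyperbolic (X : set 'rV[F]_n) p : Prop :=
  forall u x, X x -> splits (line_poly p u x).

(* The maximum with 0 only matters when the set is empty: it implements the
   convention that the supremum of the empty set is 0 (and not -oo). *)
Definition free_radius {R : realType} (N : F -> R) p u x : \bar R :=
  maxe 0%E (ereal_sup [set r%:E | r in [set r : R |
    0 <= r /\ forall z : F, N z <= r -> peval p (u + z *: x) <> 0]]).

End hyperbolic.

Section cantor_space_metric.
Context (R : realType).

(* ex_minn is the depth to which two distinct branches agree. *)
Definition cantor_dist (a b : cantor_space) : R :=
  if pselect (exists n, a n != b n) is left ab then 2 ^- ex_minn ab else 0.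

End cantor_space_metric.

Definition cylinder (s : seq bool) : set cantor_space :=
  [set a | forall i, (i < size s)%N -> a i = nth false s i].

(* The Cantor space with its Borel sigma-algebra, generated by the cylinders *)
Definition cantor_borel := g_sigma_algebraType (range cylinder).

Lemma measurable_cylinder s : measurable (cylinder s : set cantor_borel).
Proof. by apply: sub_sigma_algebra; exists s. Qed.

Definition box k (s : 'I_k -> seq bool) : set (k.-tuple cantor_borel) :=
  [set t | forall i, cylinder (s i) (tnth t i)].

Section natural_measure.
Context (R : realType).

(* The natural measure is obtained as the law of the sequence of binary digits
   of a uniform point of [0, 1[; see cantor_measureE for its characteristic
   property. *)
Definition digits (x : measurableTypeR R) : cantor_borel :=
  fun n => odd (Num.truncn (2 ^+ n.+1 * x)).

Lemma measurable_digit (n : nat) (b : bool) :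
  measurable [set x : measurableTypeR R | digits x n = b].
Proof.
have modd : measurable [set x : measurableTypeR R | digits x n = true].
  rewrite [X in measurable X](_ : _ = \bigcup_(m in [set m | odd m])
    [set` `[(m%:R / 2 ^+ n.+1 : R), (m.+1%:R / 2 ^+ n.+1 : R)[ ]); last first.
    have p0 : (0 : R) < 2 ^+ n.+1 by rewrite exprn_gt0.
    apply/seteqP; split => x /=.
      rewrite /digits => ox; exists (Num.truncn (2 ^+ n.+1 * x)) => //=.
      have xge0 : 0 <= 2 ^+ n.+1 * x.
        rewrite leNgt; apply/negP => xlt0; move: ox.
        rewrite (_ : Num.truncn _ = 0%N)//; apply/truncn0Pn.
        by rewrite -ltNge (lt_trans xlt0).
      have /andP[h1 h2] := truncn_itv xge0.
      by rewrite in_itv/= ler_pdivrMr// ltr_pdivlMr// [x * _]mulrC h1 h2.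
    move=> [m om]; rewrite /= in_itv/= ler_pdivrMr// ltr_pdivlMr//.
    by rewrite [x * _]mulrC => /truncn_def; rewrite /digits => ->.
  by apply: bigcup_measurable => m _; exact: measurable_itv.
case: b => //.
rewrite [X in measurable X](_ : _ = ~` [set x : measurableTypeR R | digits x n = true]).
  exact: measurableC.
by apply/seteqP; split => x /=; case: (digits x n).
Qed.

Lemma measurable_digits : measurable_fun [set: measurableTypeR R] digits.
Proof.
apply: (@measurability _ _ _ cantor_borel _ _ (range cylinder)) => //.
move=> _ [_ [s _ <-] <-]; rewrite setTI.
rewrite [X in measurable X](_ : _ = \bigcap_(i in `I_(size s))
    [set x : measurableTypeR R | digits x i = nth false s i]).
  apply: fin_bigcap_measurable; first exact: finite_II.
  by move=> i _; exact: measurable_digit.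
by apply/seteqP; split => x /= h i; apply: h.
Qed.

HB.instance Definition _ :=
  @isMeasurableFun.Build _ _ _ _ digits measurable_digits.

Definition uniform01 : set (measurableTypeR R) -> \bar R :=
  mrestr (@lebesgue_measure R) (measurable_itv `[0, 1[).

HB.instance Definition _ := Measure.on uniform01.

Let uniform01_setT : uniform01 [set: measurableTypeR R] = 1%E.
Proof.
rewrite /uniform01 /mrestr setTI.
by rewrite lebesgue_measure_itv/= lte_fin ltr01 sube0.
Qed.

HB.instance Definition _ :=
  Measure_isProbability.Build _ _ _ uniform01 uniform01_setT.

Definition cantor_measure : probability cantor_borel R :=
  distribution uniform01 digits.

Let bits_val (s : seq bool) : nat :=
  foldl (fun m (b : bool) => (m.*2 + b)%N) 0%N s.

Let truncn_digit (n : nat) (x : R) : 0 <= x ->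
  Num.truncn (2 ^+ n.+1 * x) = ((Num.truncn (2 ^+ n * x)).*2 + digits x n)%N.
Proof.
move=> x0; set y := 2 ^+ n * x.
have y0 : 0 <= y by rewrite mulr_ge0// exprn_ge0.
have yE : 2 ^+ n.+1 * x = 2 * y by rewrite exprS mulrA.
rewrite /digits yE.
suff -> : Num.truncn y = (Num.truncn (2 * y))./2 by rewrite addnC odd_double_half.
have y20 : 0 <= 2 * y by rewrite mulr_ge0.
apply: truncn_def; set m := Num.truncn (2 * y).
have /andP[] := truncn_itv y20; rewrite -/m => m1 m2.
have mE := odd_double_half m.
apply/andP; split.
  rewrite -(@ler_pM2l _ 2)// (le_trans _ m1)// -natrM ler_nat mul2n.
  by rewrite -{2}mE leq_addl.
rewrite -(@ltr_pM2l _ 2)// (lt_le_trans m2)// -natrM ler_nat mul2n doubleS.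
by rewrite -{1}mE; case: (odd m) => /=; rewrite ?add1n ?add0n.
Qed.

Let cylinder_itv (s : seq bool) :
  digits @^-1` cylinder s `&` [set` `[(0 : R), 1[ ] =
  [set` `[((bits_val s)%:R / 2 ^+ size s : R),
          ((bits_val s).+1%:R / 2 ^+ size s : R)[ ].
Proof.
have p0 n : (0 : R) < 2 ^+ n by rewrite exprn_gt0.
transitivity [set x : R | 0 <= x /\ Num.truncn (2 ^+ size s * x) = bits_val s].
  elim/last_ind: s => [|s b IH].
    apply/seteqP; split => x /=; rewrite in_itv/= expr0 mul1r.
      by move=> [_ /andP[x0 x1]]; split=> //; apply: truncn_def; rewrite x0.
    move=> [x0 xE]; split=> //.
    by have /andP[_] := truncn_itv x0; rewrite xE x0.
  have bE : bits_val (rcons s b) = ((bits_val s).*2 + b)%N.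
    by rewrite /bits_val -cats1 foldl_cat.
  transitivity ((digits @^-1` cylinder s `&` [set` `[(0 : R), 1[ ]) `&`
                [set x | digits x (size s) = b]).
    apply/seteqP; split => x /=.
      move=> [h ?]; split; first split=> //.
        move=> i si; have := h i; rewrite nth_rcons si size_rcons; apply.
        exact: ltnW.
      by have := h (size s); rewrite nth_rcons ltnn eqxx size_rcons; apply.
    move=> [[h ?] hb]; split => // i; rewrite size_rcons ltnS nth_rcons.
    rewrite leq_eqVlt => /orP[/eqP ->|si]; first by rewrite ltnn eqxx.
    by rewrite si; exact: h.
  rewrite IH; apply/seteqP; split => x /=.
    by move=> [[x0 xs] xb]; rewrite size_rcons truncn_digit// xs xb bE.
  move=> [x0]; rewrite size_rcons truncn_digit// bE => h.
  have hb : digits x (size s) = b.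
    by have := congr1 odd h; rewrite !oddD !odd_double !oddb.
  by split=> //; split=> //; apply/double_inj/eqP; rewrite -(eqn_add2r b) -{1}hb h.
apply/seteqP; split => x /=; rewrite in_itv/= ler_pdivrMr// ltr_pdivlMr//.
  move=> [x0 <-]; rewrite mulrC; apply: truncn_itv.
  by rewrite mulr_ge0// ltW.
rewrite mulrC => h; split; last exact: truncn_def.
rewrite -(@pmulr_rge0 _ (2 ^+ size s))//.
by case/andP: h => + _; exact: le_trans.
Qed.

Lemma cantor_measureE (s : seq bool) :
  cantor_measure (cylinder s) = (2 ^- size s)%:E.
Proof.
rewrite /cantor_measure/= /distribution /pushforward /uniform01 /mrestr.
rewrite cylinder_itv lebesgue_measure_itv/= lte_fin.
rewrite ltr_pM2r ?invr_gt0 ?exprn_gt0// ltr_nat ltnSn.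
by rewrite -EFinB -mulrBl -natrB// subSnn mul1r.
Qed.

End natural_measure.

Section natural_measure_power.
Context {R : realType}.

Definition cons_branch k (x : cantor_borel * k.-tuple cantor_borel) :
  k.+1.-tuple cantor_borel := [tuple of x.1 :: x.2].

Lemma measurable_cons_branch k :
  measurable_fun [set: cantor_borel * k.-tuple cantor_borel] (@cons_branch k).
Proof. exact: measurable_cons. Qed.

HB.instance Definition _ k := @isMeasurableFun.Build _ _ _ _
  (@cons_branch k) (@measurable_cons_branch k).

Fixpoint cantor_power k : probability (k.-tuple cantor_borel) R :=
  if k is k'.+1 return probability (k.-tuple cantor_borel) R
  then distribution (cantor_measure R \x cantor_power k')%E (@cons_branch k')
  else dirac [tuple].

Lemma measurable_box k (s : 'I_k -> seq bool) : measurable (box s).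
Proof.
rewrite [X in measurable X](_ : _ =
    \bigcap_(i in [set: 'I_k]) ((@tnth k _)^~ i @^-1` cylinder (s i))).
  apply: fin_bigcap_measurable => // i _; rewrite -[X in measurable X]setTI.
  by apply: measurable_tnth => //; exact: measurable_cylinder.
by apply/seteqP; split => t /= h i; [move=> _|]; apply: h.
Qed.

Lemma cantor_powerE k (s : 'I_k -> seq bool) :
  cantor_power k (box s) = (\prod_(i < k) 2 ^- size (s i))%:E.
Proof.
elim: k s => [|k IH] s.
  by rewrite big_ord0 /= diracE mem_set// => -[].
rewrite big_ord_recl EFinM -cantor_measureE -IH.
rewrite -product_measure1E; last 2 first.
- exact: measurable_cylinder.
- exact: measurable_box.
rewrite /= /distribution /pushforward; congr (product_measure1 _ _ _).
apply/seteqP; split => -[a t] /=.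
  by move=> h; split=> [|i]; [have := h ord0|have := h (lift ord0 i)];
    rewrite /cons_branch ?tnth0 ?tnthS.
move=> [ha ht] i; case: (unliftP ord0 i) => [j ->|->];
  by rewrite /cons_branch ?tnth0 ?tnthS//; exact: ht.
Qed.

End natural_measure_power.

Section spread.
Context {R : realType} {F : fieldType} (N : F -> R).
Implicit Types i : cantor_space -> F.

(* Homeomorphism onto the image, for the metrics cantor_dist and N (x - y) *)
Definition is_embedding i : Prop :=
  [/\ injective i,
      forall (a : cantor_space) (e : R), 0 < e -> exists2 r : R, 0 < r &
        forall b, cantor_dist R a b < r -> N (i a - i b) < e
    & forall (a : cantor_space) (e : R), 0 < e -> exists2 r : R, 0 < r &
        forall b, N (i a - i b) < r -> cantor_dist R a b < e].

Definition spread_embedding i : Prop :=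
  is_embedding i /\
  exists C g : R, [/\ 0 < C, 0 < g &
    forall a b, C * cantor_dist R a b `^ g <= N (i a - i b)].

Definition affine_spread k (Y : set 'rV[F]_k) : Prop :=
  exists i : 'I_k -> cantor_space -> F,
    (forall j, spread_embedding (i j)) /\
    (0 < (@cantor_power R k)^*%mu
           [set t : k.-tuple cantor_borel | Y (\row_j i j (tnth t j))])%E.

Definition dehomogenize d (X : set 'rV[F]_d.+1) : set 'rV[F]_d :=
  [set \row_j (x 0 (lift ord0 j) / x 0 ord0) | x in
    [set x | X x /\ x 0 ord0 <> 0]].

Definition spread d (X : set 'rV[F]_d.+1) : Prop :=
  affine_spread (dehomogenize X).

End spread.

(* Main.v *)
Require Import Defs.
From mathcomp Require Import all_boot all_order all_algebra.
From mathcomp Require Import all_classical all_reals all_analysis.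
From mathcomp Require Import ring lra zify.
From mathcomp Require mpoly.
Set Implicit Arguments.
Unset Strict Implicit.
Unset Printing Implicit Defensive.
Import Order.TTheory GRing.Theory Num.Theory.
Local Open Scope ring_scope.

(* Suppose that p(w) = 0 but p(u + zx) <> 0 for all x in X and |z| <= rho.  Write
   A_x(z) = p(u + zx) / p(u) and 1 / A_x(z) = sum_k h_k(x) z^k, where h_k is a
   homogeneous polynomial of degree k in x.  For x in X, hyperbolicity gives
   A_x(z) = prod_i (1 - b_i z) with |b_i| < 1 / rho, so h_k(x), the complete
   symmetric function of the b_i, is at most 2^(n+k) / rho^k.
   A Remez-type inequality on spread sets turns this into a bound B D^(k+1) on
   the coefficients of h_k: in one variable by Lagrange interpolation at k+1
   points whose mutual distances have product at least c^(k+1), in several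
   variables by slicing.  To avoid measurability questions the slicing is done
   on finite sets of words of length L: a polynomial in the embeddings is
   uniformly continuous on the Cantor space, so for large L a word can be
   replaced by the single branch that continues it by zeros.
   Hence h_k(w - u) tends to 0 if |w - u| is small compared with rho, while
   A_{w-u}(1) = 0 makes A_{w-u}(z) / (1 - z) a polynomial whose product with
   sum_k h_k(w - u) z^k is 1 + z + z^2 + ..., which is absurd. *)

(** * Norms, interpolation and reciprocal power series *)

Section norm.
Context {R : realType} {F : fieldType} {N : F -> R} (normN : is_norm N).

Lemma normf0 : N 0 = 0.
Proof. exact/(norm_eq0 normN). Qed.

Lemma normf_gt0 x : x != 0 -> 0 < N x.
Proof.
move=> x0; rewrite lt_def (norm_ge0 normN) andbT.
by apply: contra_neq x0 => /(norm_eq0 normN).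
Qed.

Lemma normf1 : N 1 = 1.
Proof.
have n1 : N 1 != 0 by rewrite gt_eqF// normf_gt0// oner_eq0.
by apply: (mulfI n1); rewrite -(normM normN) !mulr1.
Qed.

Lemma normfX x n : N (x ^+ n) = N x ^+ n.
Proof.
by elim: n => [|n IH]; rewrite ?expr0 ?normf1// !exprS (normM normN) IH.
Qed.

Lemma normfN x : N (- x) = N x.
Proof.
have : N (- x) ^+ 2 = N x ^+ 2 by rewrite -!normfX sqrrN.
by move/eqP; rewrite eqrXn2 ?(norm_ge0 normN)// => /eqP.
Qed.

Lemma normfV x : N x^-1 = (N x)^-1.
Proof.
have [->|x0] := eqVneq x 0; first by rewrite invr0 normf0 invr0.
have nx0 := gt_eqF (normf_gt0 x0).
by apply: (mulfI (negbT nx0)); rewrite -(normM normN) !divff ?normf1 ?nx0.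
Qed.

Lemma normf_div x y : N (x / y) = N x / N y.
Proof. by rewrite (normM normN) normfV. Qed.

Lemma normf_prod I (r : seq I) (P : pred I) (f : I -> F) :
  N (\prod_(i <- r | P i) f i) = \prod_(i <- r | P i) N (f i).
Proof. by apply: (big_morph N (normM normN) normf1). Qed.

Lemma ler_normf_sum I (r : seq I) (P : pred I) (f : I -> F) :
  N (\sum_(i <- r | P i) f i) <= \sum_(i <- r | P i) N (f i).
Proof.
elim/big_ind2 : _ => [|x a y b xa yb|//]; first by rewrite normf0.
by apply: le_trans (normD normN _ _) _; exact: lerD.
Qed.

(** A factor ['X - y%:P] shifts the coefficients and subtracts their multiple by [y], so a bound
    common to all of them grows at most by [1 + N y]. *)
Lemma normf_coef_prod_XsubC I (r : seq I) (P : pred I) (y : I -> F) j :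
  N (\prod_(i <- r | P i) ('X - (y i)%:P))`_j <=
  \prod_(i <- r | P i) (1 + N (y i)).
Proof.
elim: r j => [|i r IH] j.
  by rewrite !big_nil coef1; case: eqP; rewrite ?normf1 ?normf0.
rewrite !big_cons; case: (P i) => //.
rewrite mulrBl coefB coefCM coefXM.
apply: le_trans (normD normN _ _) _; rewrite mulrDl mul1r normfN (normM normN).
apply: lerD; last by rewrite ler_wpM2l// (norm_ge0 normN).
case: eqP => // _; rewrite normf0 prodr_ge0// => k _.
by rewrite addr_ge0// (norm_ge0 normN).
Qed.

(** The difference of both sides has size at most [#|Q|] and vanishes at [#|Q|] distinct nodes. *)
Lemma lagrange_interpolation (T : finType) (Q : {set T}) (y : T -> F)
    (g : {poly F}) :
  (size g <= #|Q|)%N -> {in Q &, injective y} ->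
  g = \sum_(a in Q) (g.[y a] / \prod_(b in Q | b != a) (y a - y b)) *:
        \prod_(b in Q | b != a) ('X - (y b)%:P).
Proof.
move=> sg yinj; apply/eqP; rewrite -subr_eq0; apply/eqP.
set h := (X in g - X).
apply: (@roots_geq_poly_eq0 _ _ [seq y a | a <- enum Q]).
- apply/allP => _ /mapP[a aQ ->]; rewrite mem_enum in aQ.
  rewrite /root !hornerE horner_sum (bigD1 a)//= [X in _ - (_ + X)]big1 ?addr0
    => [|b /andP[bQ ba]].
    rewrite hornerZ horner_prod; under [X in _ / _ * X]eq_bigr do
      rewrite hornerXsubC.
    rewrite divfK ?subrr//; apply/prodf_neq0 => b /andP[bQ ba].
    by rewrite subr_eq0 (inj_in_eq yinj)// eq_sym.
  rewrite hornerZ horner_prod [X in _ * X](bigD1 a) ?aQ 1?eq_sym//=.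
  by rewrite hornerXsubC subrr mul0r mulr0.
- by rewrite map_inj_in_uniq ?enum_uniq// => a b; rewrite !mem_enum; exact: yinj.
- rewrite size_map -cardE; apply: leq_trans (size_polyD _ _) _.
  rewrite geq_max sg size_polyN /=; apply: (leq_trans (size_sum _ _ _)).
  apply/bigmax_leqP => a aQ; apply: (leq_trans (size_scale_leq _ _)).
  rewrite -(big_filter (index_enum T)) size_prod_XsubC size_filter.
  rewrite -sum1_count -(big_filter (index_enum T)) big_filter -sum1_card.
  by rewrite [leqRHS](bigD1 a).
Qed.

(** The Lagrange terms are bounded one by one; [0 < del] already forces the nodes to be distinct. *)
Lemma normf_coef_interpolation (T : finType) (Q : {set T}) (y : T -> F)
    (g : {poly F}) (B M del : R) j :
  (size g <= #|Q|)%N -> 0 < del -> 0 <= B ->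
  (forall a, a \in Q -> N (y a) <= M) ->
  (forall a, a \in Q -> N g.[y a] <= B) ->
  (forall a, a \in Q -> del <= \prod_(b in Q | b != a) N (y a - y b)) ->
  N g`_j <= #|Q|%:R * (B / del * (1 + M) ^+ #|Q|.-1).
Proof.
move=> sg del0 B0 yM gB dely.
have yinj : {in Q &, injective y}.
  move=> a b aQ bQ yab; apply/eqP/negPn/negP => neqab.
  have := lt_le_trans del0 (dely a aQ).
  by rewrite (bigD1 b) ?bQ 1?eq_sym//= yab subrr normf0 mul0r ltxx.
rewrite [g](lagrange_interpolation sg yinj) coef_sum.
apply: le_trans (ler_normf_sum _ _ _) _.
rewrite mulr_natl -sumr_const; apply: ler_sum => a aQ.
rewrite coefZ (normM normN) normf_div normf_prod.
have p0 := lt_le_trans del0 (dely a aQ).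
apply: ler_pM; rewrite ?(norm_ge0 normN)//.
- by rewrite divr_ge0// ?(norm_ge0 normN)// ltW.
- apply: ler_pM; rewrite ?(norm_ge0 normN) ?invr_ge0 ?(ltW p0) ?gB//.
  by rewrite lef_pV2// ?posrE// dely.
- apply: (le_trans (normf_coef_prod_XsubC _ _ _ _)).
  have -> : #|Q|.-1 = #|Q :\ a| by rewrite (cardsD1 a Q) aQ.
  rewrite -prodr_const; rewrite (eq_bigl (mem (Q :\ a))) => [|b]; last first.
    by rewrite !inE andbC.
  apply: ler_prod => b; rewrite !inE => /andP[_ bQ].
  by rewrite lerD2l yM// addr_ge0// (norm_ge0 normN).
Qed.

End norm.

Section reciprocal.
Context {F : fieldType}.
Implicit Types (A : {poly F}) (h : nat -> F).

(** The power series with coefficients [h] is the formal inverse of [A]. *)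
Definition reciprocal A h :=
  forall k, \sum_(i < k.+1) A`_i * h (k - i)%N = (k == 0%N)%:R.

Lemma reciprocalP A h : reciprocal A h <->
  forall K k, (k < K)%N -> (A * \poly_(i < K) h i)`_k = (k == 0%N)%:R.
Proof.
split=> [Ah K k kK|Ah k].
  rewrite coefM -(Ah k); apply: eq_bigr => i _; rewrite coef_poly.
  by rewrite (leq_ltn_trans (leq_subr _ _) kK).
rewrite -(Ah k.+1 k)// coefM; apply: eq_bigr => i _.
by rewrite coef_poly ltnS leq_subr.
Qed.

(* Coefficient k of 1 / A when A`_0 = 1: the terms with j > k of the geometric
   series do not contribute. *)
Definition geom_inv A (k : nat) : F := (\sum_(j < k.+1) (1 - A) ^+ j)`_k.

Lemma coef_expr_lt (q : {poly F}) n k : q`_0 = 0 -> (k < n)%N -> (q ^+ n)`_k = 0.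
Proof.
move=> q0; elim: n k => // n IH k; rewrite ltnS => kn.
rewrite exprS coefM big1// => -[[|i] ilt] _ /=; first by rewrite q0 mul0r.
by rewrite IH ?mulr0//; case: k kn ilt => //= k kn _; rewrite subSS; lia.
Qed.

Lemma reciprocal_geom_inv A : A`_0 = 1 -> reciprocal A (geom_inv A).
Proof.
move=> A0; have q0 : (1 - A)`_0 = 0 by rewrite coefB coef1 eqxx A0 subrr.
move=> k; transitivity (A * \sum_(j < k.+1) (1 - A) ^+ j)`_k.
  rewrite coefM; apply: eq_bigr => i _; congr (_ * _).
  (* Lengthening the geometric sum does not affect coefficient [k - i], because [1 - A] is divisible
     by ['X]. *)
  rewrite /geom_inv -!(big_mkord xpredT (fun j => (1 - A) ^+ j)).
  rewrite [in RHS](@big_cat_nat _ _ _ (k - i).+1)//=; last by rewrite ltnS leq_subr.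
  rewrite coefD -[LHS]addr0; congr (_ + _).
  rewrite coef_sum big_nat big1// => j /andP[kj _].
  by rewrite coef_expr_lt.
(* The sum telescopes: [A] times it is [1 - (1 - A) ^+ k.+1], and the last power does not reach
   coefficient [k]. *)
have {1}-> : A = - ((1 - A) - 1) by rewrite addrAC subrr sub0r opprK.
rewrite mulNr -subrX1 opprB coefB coef1.
by rewrite coef_expr_lt// subr0.
Qed.

(** Multiplying the series by [1 - b *: 'X] cancels that factor of the polynomial, so linear factors
    can be removed one at a time. *)
Lemma reciprocal_factor b A h : reciprocal ((1 - b *: 'X) * A) h ->
  reciprocal A (fun k => h k - b * (if k is k'.+1 then h k' else 0)).
Proof.
move/reciprocalP => Ah; apply/reciprocalP => K k kK.
rewrite -(Ah K k kK) mulrAC mulrC !coefM; apply: eq_bigr => i _; congr (_ * _).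
have iK : (i < K)%N by apply: leq_trans kK; exact: ltn_ord.
rewrite coef_poly iK mulrBl mul1r coefB coef_poly iK -scalerAl coefZ coefXM.
by case: (nat_of_ord i) iK => [|j] //= jK; rewrite coef_poly (ltnW jK).
Qed.

End reciprocal.

(** * Counting words *)

Lemma big_tuple_cons (V : Type) (idx : V) (op : Monoid.com_law idx) (A : finType)
    n (f : n.+1.-tuple A -> V) :
  \big[op/idx]_(t : n.+1.-tuple A) f t =
  \big[op/idx]_(a : A) \big[op/idx]_(t : n.-tuple A) f [tuple of a :: t].
Proof.
rewrite pair_big_dep/= (reindex (fun p : A * n.-tuple A => [tuple of p.1 :: p.2])).
  by [].
exists (fun t => (thead t, [tuple of behead t])) => [[a t] _|t _] /=.
  by congr pair; apply: val_inj.
by rewrite -tuple_eta.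
Qed.

Fixpoint common_prefix (a b : seq bool) : nat :=
  if (a, b) is (x :: a', y :: b') then
    if x == y then (common_prefix a' b').+1 else 0%N
  else 0%N.

(** Half of the words differ from [a] in the first letter and contribute 0; the others contribute
    one more than their tails, so passing from length [l] to [l.+1] adds at most [2 ^ l]. The
    average common prefix thus stays bounded. *)
Lemma sum_common_prefix l (a : l.-tuple bool) :
  (\sum_(b : l.-tuple bool | b != a) common_prefix a b <= 2 ^ l)%N.
Proof.
rewrite big_mkcond; elim: l a => [a|l IH].
  by rewrite big1// => b _; rewrite [b]tuple0 [a]tuple0.
case/tupleP=> x a; rewrite (big_tuple_cons addn) (bigD1 x)//=.
rewrite [X in (_ + X)%N]big1; last first.
  by move=> y xy; apply: big1 => t _; rewrite [x == y]eq_sym (negbTE xy) if_same.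
rewrite addn0 expnS mul2n -addnn eqxx.
apply: (@leq_trans (\sum_(t : l.-tuple bool)
    (1 + if t != a then common_prefix a t else 0)))%N.
  apply: leq_sum => t _; rewrite -val_eqE /= eqseq_cons eqxx /= val_eqE.
  by case: ifP.
rewrite big_split/=; apply: leq_add; last exact: IH.
by rewrite sum1_card card_tuple card_bool.
Qed.

Definition trunc L l (a : L.-tuple bool) : l.-tuple bool :=
  [tuple nth false a i | i < l].

Lemma nth_trunc L l (a : L.-tuple bool) i : (i < l)%N ->
  nth false (trunc l a) i = nth false a i.
Proof. by move=> il; rewrite -(nth_mktuple (fun i : 'I_l => nth false a i) false (Ordinal il)). Qed.

Lemma card_imset_trunc L l (lL : (l <= L)%N) (T : {set L.-tuple bool}) :
  (#|T| <= #|trunc l @: T| * 2 ^ (L - l))%N.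
Proof.
pose f (a : L.-tuple bool) : l.-tuple bool * (L - l).-tuple bool :=
  (trunc l a, [tuple nth false a (l + i) | i < L - l]).
have finj : {in T &, injective f}.
  move=> a b _ _ fab; apply/val_inj/(@eq_from_nth _ false).
    by rewrite !size_tuple.
  move=> i; rewrite size_tuple => iL; have [il|li] := ltnP i l.
    by rewrite -(nth_trunc a il) -(nth_trunc b il) (congr1 fst fab : trunc l a = trunc l b).
  have iLl : (i - l < L - l)%N by rewrite ltn_sub2r// (leq_ltn_trans li).
  have := congr1 (fun t => tnth t (Ordinal iLl)) (congr1 snd fab).
  by rewrite !tnth_mktuple /= subnKC.
rewrite -(card_in_imset finj).
have <- : #|[set: (L - l).-tuple bool]| = (2 ^ (L - l))%N.
  by rewrite cardsT card_tuple card_bool.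
rewrite -cardsX; apply/subset_leq_card/fintype.subsetP => _ /imsetP[a aT ->].
by rewrite finset.in_setX finset.in_setT andbT imset_f.
Qed.

(** A Markov argument: slices of density below [2 ^- e.+1] account for at most half of the density
    guaranteed for [S], and the rest must lie over the remaining first letters. *)
Lemma slice_count (A : finType) d e (S : {set d.+1.-tuple A}) :
  (#|A| ^ d.+1 <= 2 ^ e * #|S|)%N ->
  (#|A| <= 2 ^ e.+1 * #|[set a : A | #|A| ^ d <=
     2 ^ e.+1 * #|[set t : d.-tuple A | [tuple of a :: t] \in S]| ]|)%N.
Proof.
move=> hS; set T := [set a | _].
have [A0|A0] := posnP #|A|; first by rewrite A0.
have Ad : (0 < #|A| ^ d)%N by rewrite expn_gt0 A0.
have sumS : #|S| = (\sum_(a : A) #|[set t : d.-tuple A | [tuple of a :: t] \in S]|)%N.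
  rewrite -sum1_card big_mkcond (big_tuple_cons addn); apply: eq_bigr => a _.
  rewrite -sum1_card [RHS]big_mkcond; apply: eq_bigr => t _.
  by rewrite inE.
(* The term [#|A| ^ d.+1] added on both sides doubles the left one and pays for the small slices on
   the right. *)
rewrite -(leq_pmul2r Ad) -expnS -(leq_add2r (#|A| ^ d.+1)) addnn -mul2n.
apply: (@leq_trans (2 ^ e.+1 * #|S|)).
  by rewrite [(2 ^ e.+1)%N]expnS -mulnA leq_mul2l.
rewrite sumS big_distrr /= (bigID (mem T)) /=; apply: leq_add.
  rewrite -mulnA -sum_nat_const big_distrr/=; apply: leq_sum => a _.
  by rewrite leq_mul2l -card_tuple max_card orbT.
apply: (@leq_trans (\sum_(a | a \notin T) #|A| ^ d)).
  by apply: leq_sum => a; rewrite finset.inE -ltnNge => /ltnW.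
by rewrite sum_nat_const expnS leq_mul2r max_card orbT.
Qed.

(** * Remez inequality *)

Lemma common_prefixP (a b : seq bool) : size a = size b -> a != b ->
  [/\ (common_prefix a b < size a)%N,
      nth false a (common_prefix a b) != nth false b (common_prefix a b) &
      forall i, (i < common_prefix a b)%N -> nth false a i = nth false b i].
Proof.
elim: a b => [|x a IH] [|y b] //= [sab].
rewrite eqseq_cons negb_and; case: eqVneq => [->|xy] //= ab.
have [h1 h2 h3] := IH b sab ab; split=> // -[|i] //=.
by rewrite ltnS; exact: h3.
Qed.

Lemma cantor_dist_common_prefix (R : realType) (x y : cantor_space) (a b : seq bool) :
  size a = size b -> a != b ->
  (forall i, (i < size a)%N -> nth false a i = x i) ->
  (forall i, (i < size b)%N -> nth false b i = y i) ->
  cantor_dist R x y = 2 ^- common_prefix a b.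
Proof.
move=> sab ab ax byy; have [h1 h2 h3] := common_prefixP sab ab.
rewrite /cantor_dist; case: pselect => [xy|[]]; last first.
  by exists (common_prefix a b); rewrite -ax// -byy// -sab.
congr (2 ^- _); case: ex_minnP => n nxy nmin; apply/eqP; rewrite eqn_leq nmin/=.
  rewrite leqNgt; apply/negP => nc; move/eqP: nxy; apply.
  have na := ltn_trans nc h1.
  by rewrite -ax// -byy -?sab// h3.
by rewrite -ax// -byy// -sab.
Qed.

Definition pad (a : seq bool) : cantor_space := fun n => nth false a n.

Section spread_points.
Context {R : realType} {F : fieldType} {N : F -> R} (normN : is_norm N).

(** A pair with common prefix of length [n] contributes at least [C * th ^+ n], and the exponents
    add up to at most [2 ^ l]. The map [s] allows each prefix to be represented by any longer word
    extending it. *)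
Lemma spread_product_bound (i : cantor_space -> F) : spread_embedding N i ->
  exists C th : R, [/\ 0 < C <= 1, 0 < th <= 1 &
    forall (L l k : nat) (s : l.-tuple bool -> L.-tuple bool) (Q : {set l.-tuple bool}),
      (l <= L)%N -> #|Q| = k.+1 -> {in Q, forall b, trunc l (s b) = b} ->
      {in Q, forall a, C ^+ k * th ^+ (2 ^ l) <=
        \prod_(b in Q | b != a) N (i (pad (s a)) - i (pad (s b)))}].
Proof.
move=> [_ [C [g [C0 g0 Cg]]]].
(* Capping the constant at 1 allows its exponent to be increased later. *)
set C' := Num.min C 1; set th := 2^-1 `^ g.
have C'0 : 0 < C' by rewrite lt_min C0 ltr01.
have th0 : 0 < th by rewrite powR_gt0 ?invr_gt0.
have th1 : th <= 1.
  suff : th <= 1 `^ g by rewrite powR1.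
  by apply: ge0_ler_powR; rewrite ?nnegrE ?invr_ge0 ?(ltW g0)// invf_le1// ler1n.
exists C', th; split; first by rewrite C'0 ge_min lexx orbT.
  by rewrite th0.
move=> L l k s Q lL cQ sQ a aQ; have C'0w := ltW C'0; have th0w := ltW th0.
apply: (@le_trans _ _ (\prod_(b in Q | b != a) (C' * th ^+ common_prefix a b))).
  rewrite big_split/=; apply: ler_pM; rewrite ?exprn_ge0 ?(ltW C0) ?(ltW th0)//.
    rewrite prodr_const (_ : #|_| = k)//.
    have := cQ; rewrite (cardsD1 a) aQ add1n => -[<-].
    by apply: fintype.eq_card => b; rewrite !inE unfold_in andbC.
  rewrite prodrXr; apply: ler_wiXn2l => //.
  apply: leq_trans (sum_common_prefix a).
  rewrite big_mkcondl; apply: leq_sum => b _; by case: ifP.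
apply: ler_prod => b /andP[bQ ba]; rewrite mulr_ge0 ?exprn_ge0//=.
apply: le_trans (Cg _ _).
have tS (c : l.-tuple bool) (cQ' : c \in Q) n : (n < size c)%N ->
    nth false c n = pad (s c) n.
  by rewrite size_tuple => nl; rewrite -[in LHS](sQ c cQ') nth_trunc.
rewrite (@cantor_dist_common_prefix _ _ _ a b) ?size_tuple//; first last.
- by move=> n nl; apply: tS => //; rewrite size_tuple.
- by move=> n nl; apply: tS => //; rewrite size_tuple.
- by rewrite eq_sym.
apply: ler_pM => //; rewrite ?exprn_ge0//; first by rewrite ge_min lexx.
by rewrite /th -exprVn -!powR_mulrn ?powR_ge0 ?invr_ge0// powRAC.
Qed.

(* Keeping one point of T for each of k+1 prefixes of length l, where 2^l is of
   the order of (k+1) 2^e, makes the products of mutual distances at least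
   c^(k+1), by sum_common_prefix. *)
Lemma remez_line (i : cantor_space -> F) (M : R) (e : nat) :
  spread_embedding N i -> (forall t, N (i t) <= M) ->
  exists2 D : R, 0 < D & forall k, exists L0, forall L, (L0 <= L)%N ->
    forall T : {set L.-tuple bool}, (2 ^ L <= 2 ^ e * #|T|)%N ->
    forall (g : {poly F}) (B : R), (size g <= k.+1)%N -> 0 <= B ->
      (forall a : L.-tuple bool, a \in T -> N g.[i (pad a)] <= B) ->
      forall j, N g`_j <= B * D ^+ k.+1.
Proof.
move=> spi iM; have [C [th [/andP[C0 C1] /andP[th0 th1] prodB]]] := spread_product_bound spi.
have M0 : 0 <= M by apply: le_trans (iM (pad [::])); exact: norm_ge0 normN _.
(* For the length [l] chosen below, [2 ^ l] is at most [2 ^ e.+1 * k.+1], so [be ^+ k.+1] is a lower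
   bound for the products of distances. In the constant that follows, the factor 2 absorbs the
   number [k.+1] of Lagrange terms. *)
pose be := C * th ^+ (2 ^ e.+1).
have be0 : 0 < be by rewrite mulr_gt0// exprn_gt0.
exists (2 * (1 + M) / be); first by rewrite divr_gt0// mulr_gt0// ltr_pwDl.
move=> k; pose ka := up_log 2 k.+1; pose l := (ka + e)%N.
exists l => L lL T hT g B sg B0 gB j.
have [lek geK] : (k.+1 <= 2 ^ ka)%N /\ (2 ^ ka <= 2 * k.+1)%N.
  split; first exact: up_logP.
  rewrite /ka; case: k {sg l lL} @ka => [|k ka]; first by rewrite up_log1.
  have := @up_log_gtn 2 k.+2 isT isT; rewrite -/ka => h.
  have : (0 < ka)%N by rewrite up_log_gt0.
  by case: ka h => // m /= h _; rewrite expnS leq_mul2l ltnW.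
pose P := @trunc L l @: T.
(* A prefix has at most [2 ^ (L - l)] extensions, so the density of [T] leaves at least
   [2 ^ (l - e)] prefixes, that is [2 ^ ka]. *)
have cP : (k.+1 <= #|P|)%N.
  apply: (leq_trans lek); rewrite -(@leq_pmul2l (2 ^ e)) ?expn_gt0//.
  rewrite -(@leq_pmul2r (2 ^ (L - l))) ?expn_gt0// -expnD addnC -/l -expnD subnKC//.
  apply: (leq_trans hT); rewrite -mulnA leq_mul2l card_imset_trunc ?orbT//.
pose Q := [set x in take k.+1 (enum P)].
have cQ : #|Q| = k.+1.
  rewrite cardsE (card_uniqP _) ?take_uniq ?enum_uniq// size_take -cardE.
  by move: cP; rewrite leq_eqVlt => /predU1P[->|->]; rewrite ?ltnn ?if_same.
have QP b : b \in Q -> b \in P by rewrite inE => /mem_take; rewrite mem_enum.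
(* A word of [T] with prefix [b]; the default value is never reached for [b] in [Q]. *)
pose s (b : l.-tuple bool) : L.-tuple bool :=
  odflt [tuple of nseq L false] [pick a in T | trunc l a == b].
have sP b : b \in Q -> s b \in T /\ trunc l (s b) = b.
  move=> /QP /imsetP[a aT ->]; rewrite /s; case: pickP => [c /andP[cT /eqP]//|].
  by move=> /(_ a); rewrite aT eqxx.
have -> : B * (2 * (1 + M) / be) ^+ k.+1 =
    2 ^+ k.+1 * (B / be ^+ k.+1 * (1 + M) ^+ k.+1).
  have shuffle (w x y z : R) : w * (x * y * z) = x * (w * z * y) by ring.
  by rewrite expr_div_n [(2 * (1 + M)) ^+ _]exprMn shuffle.
have M1 : 0 <= 1 + M by rewrite addr_ge0.
apply: (@le_trans _ _ (k.+1%:R * (B / be ^+ k.+1 * (1 + M) ^+ k))).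
  rewrite -cQ -[X in (1 + M) ^+ X]/(k.+1.-1) -[in (1 + M) ^+ _]cQ.
  apply: (normf_coef_interpolation normN (y := fun b => i (pad (s b)))) => //.
  - by rewrite cQ.
  - by rewrite exprn_gt0.
  - by move=> a aQ; apply: gB; have [] := sP a aQ.
  move=> a aQ; rewrite cQ; apply: le_trans (prodB L l k s Q lL cQ _ a aQ).
    rewrite exprMn -exprM; apply: ler_pM; rewrite ?exprn_ge0 ?(ltW C0) ?(ltW th0)//.
      by rewrite exprS ler_piMl// exprn_ge0// ltW.
    apply: ler_wiXn2l; rewrite ?(ltW th0)//.
    by rewrite /l expnD expnS mulnAC leq_mul2r geK orbT.
  by move=> b bQ; have [] := sP b bQ.
apply: ler_pM => //.
- by rewrite mulr_ge0 ?exprn_ge0// divr_ge0// exprn_ge0// ltW.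
- by rewrite -natrX ler_nat ltnW// ltn_expl.
- rewrite ler_wpM2l ?divr_ge0 ?exprn_ge0 ?(ltW be0)//.
  by rewrite exprS ler_peMl ?exprn_ge0// lerDl.
Qed.

End spread_points.

(** * Uniform continuity on powers of the Cantor space *)

Section uniform_continuity.
Context {R : realType} {F : fieldType} {N : F -> R} (normN : is_norm N).

Definition agree d n (t t' : 'I_d -> cantor_space) :=
  forall j m, (m < n)%N -> t j m = t' j m.

Definition cylinder_continuous d (g : ('I_d -> cantor_space) -> F) :=
  forall t (e : R), 0 < e ->
    exists n, forall t', agree n t t' -> N (g t - g t') < e.

(* Koenig's lemma: a box on which no depth works contains a smaller one of the
   same kind, and these boxes shrink to a point of discontinuity. *)
Lemma cylinder_continuous_uniform d (g : ('I_d -> cantor_space) -> F) :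
  cylinder_continuous g -> forall e : R, 0 < e ->
  exists n, forall t t', agree n t t' -> N (g t - g t') < e.
Proof.
move=> gc e e0.
pose good n t := exists m, forall t1 t2, agree n t t1 -> agree m t1 t2 ->
  N (g t1 - g t2) < e.
(* A box has finitely many children, one for each choice of letter [n] in every coordinate, so the
   largest of their depths serves the whole box. *)
have good_refine n t : (forall t', agree n t t' -> good n.+1 t') -> good n t.
  move=> H.
  pose ext (s : {ffun 'I_d -> bool}) : 'I_d -> cantor_space :=
    fun j m => if m == n then s j else t j m.
  have /boolp.choice[M MP] : forall s, good n.+1 (ext s).
    move=> s; apply: H => j m mn.
    by rewrite /ext; case: eqP mn => // ->; rewrite ltnn.
  exists (\max_s M s)%N => t1 t2 tt1 t12.
  apply: (MP [ffun j => t1 j n]) => [j m|j m mM].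
    rewrite ltnS leq_eqVlt /ext => /predU1P[->|mn]; first by rewrite eqxx ffunE.
    by case: eqP mn => [->|_ /tt1]; rewrite ?ltnn.
  by apply: t12; apply: leq_trans mM _; exact: leq_bigmax.
suff [m mP] : good 0%N (fun _ _ => false) by exists m => t t'; exact: mP.
apply: contrapT => bad0.
(* A child is chosen for every box, and it is bad whenever its parent is; iterating [f] gives the
   nested bad boxes. *)
have /boolp.choice[f fP] : forall p : nat * ('I_d -> cantor_space),
    exists t, agree p.1 p.2 t /\ (~ good p.1 p.2 -> ~ good p.1.+1 t).
  move=> [n t] /=; have [gnt|bnt] := pselect (good n t).
    by exists t; split.
  apply: contrapT => H; apply: bnt; apply: good_refine => t' tt'.
  by apply: contrapT => bt'; apply: H; exists t'.
pose u := fix u n := if n is n'.+1 then f (n', u n') else (fun _ _ => false).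
have u_bad n : ~ good n (u n).
  by elim: n => [//|n IH] /=; apply: (fP (n, u n)).2.
have u_agree n k : agree n (u n) (u (n + k)%N).
  elim: k => [|k IH] j m mn; first by rewrite addn0.
  rewrite IH// addnS /=; apply: (fP (_, _)).1 => /=.
  by rewrite (leq_trans mn)// leq_addr.
pose a : 'I_d -> cantor_space := fun j m => u m.+1 j m.
have ua n : agree n (u n) a.
  move=> j m mn; rewrite /a -(subnKC mn); symmetry.
  exact: u_agree.
have [n nP] := gc a (e / 2) (divr_gt0 e0 (ltr0Sn R 1)).
apply: (u_bad n); exists n => t1 t2 ut1 t12.
have a1 : agree n a t1 by move=> j m mn; rewrite -(ua n)// ut1.
have a2 : agree n a t2 by move=> j m mn; rewrite a1// t12.
have -> : g t1 - g t2 = - (g a - g t1) + (g a - g t2) by ring.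
rewrite [e]splitr; apply: le_lt_trans (normD normN _ _) _.
by rewrite (normfN normN); apply: ltrD; exact: nP.
Qed.

Lemma cylinder_continuous_cst d (x : F) :
  cylinder_continuous (fun _ : 'I_d -> cantor_space => x).
Proof. by move=> t e e0; exists 0%N => t' _; rewrite subrr (normf0 normN). Qed.

Lemma agree_le d m n (t t' : 'I_d -> cantor_space) :
  (m <= n)%N -> agree n t t' -> agree m t t'.
Proof. by move=> mn tt' j i im; apply: tt'; exact: leq_trans mn. Qed.

Lemma cylinder_continuousD d (g h : ('I_d -> cantor_space) -> F) :
  cylinder_continuous g -> cylinder_continuous h ->
  cylinder_continuous (fun t => g t + h t).
Proof.
move=> gc hc t e e0; have e2 : 0 < e / 2 by rewrite divr_gt0.
have [m mP] := gc t _ e2; have [n nP] := hc t _ e2.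
exists (maxn m n) => t' tt'; rewrite opprD addrACA [e]splitr.
apply: le_lt_trans (normD normN _ _) _; apply: ltrD.
  by apply: mP; apply: agree_le tt'; rewrite leq_maxl.
by apply: nP; apply: agree_le tt'; rewrite leq_maxr.
Qed.

Lemma cylinder_continuousM d (g h : ('I_d -> cantor_space) -> F) :
  cylinder_continuous g -> cylinder_continuous h ->
  cylinder_continuous (fun t => g t * h t).
Proof.
move=> gc hc t e e0.
have G0 : 0 < N (g t) + 1 by rewrite ltr_wpDl// (norm_ge0 normN).
have H0 : 0 < N (h t) + 1 by rewrite ltr_wpDl// (norm_ge0 normN).
have e2 : 0 < e / 2 by rewrite divr_gt0.
have [m mP] := gc t _ (divr_gt0 e2 H0).
(* The bound 1 keeps [N (h t')] below [N (h t) + 1], the divisor used in the choice of [m]. *)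
have m0 : 0 < Num.min 1 (e / 2 / (N (g t) + 1)) by rewrite lt_min ltr01 divr_gt0.
have [n nP] := hc t _ m0.
exists (maxn m n) => t' tt'.
have /mP gt' : agree m t t' by apply: agree_le tt'; rewrite leq_maxl.
have /nP : agree n t t' by apply: agree_le tt'; rewrite leq_maxr.
rewrite lt_min => /andP[ht1 ht'].
have -> : g t * h t - g t' * h t' = g t * (h t - h t') + (g t - g t') * h t'.
  by ring.
apply: le_lt_trans (normD normN _ _) _; rewrite [e]splitr !(normM normN).
apply: ler_ltD.
  rewrite ltr_pdivlMr// in ht'; apply: le_trans (ltW ht').
  by rewrite mulrC ler_wpM2l ?(norm_ge0 normN)// lerDl.
rewrite ltr_pdivlMr// in gt'; apply: le_lt_trans gt'.
rewrite ler_wpM2l ?(norm_ge0 normN)//.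
have -> : h t' = h t + - (h t - h t') by ring.
apply: le_trans (normD normN _ _) _; rewrite (normfN normN).
by rewrite lerD2l ltW.
Qed.

Lemma cylinder_continuous_sum d I (r : seq I) (f : I -> ('I_d -> cantor_space) -> F) :
  (forall i, cylinder_continuous (f i)) ->
  cylinder_continuous (fun t => \sum_(i <- r) f i t).
Proof.
move=> fc; elim: r => [|i r IH].
  by under boolp.eq_fun do rewrite big_nil; exact: cylinder_continuous_cst.
by under boolp.eq_fun do rewrite big_cons; exact: cylinder_continuousD.
Qed.

Lemma cylinder_continuous_prod d I (r : seq I) (f : I -> ('I_d -> cantor_space) -> F) :
  (forall i, cylinder_continuous (f i)) ->
  cylinder_continuous (fun t => \prod_(i <- r) f i t).
Proof.
move=> fc; elim: r => [|i r IH].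
  by under boolp.eq_fun do rewrite big_nil; exact: cylinder_continuous_cst.
by under boolp.eq_fun do rewrite big_cons; exact: cylinder_continuousM.
Qed.

Lemma cylinder_continuousX d n (g : ('I_d -> cantor_space) -> F) :
  cylinder_continuous g -> cylinder_continuous (fun t => g t ^+ n).
Proof.
move=> gc; elim: n => [|n IH].
  by under boolp.eq_fun do rewrite expr0; exact: cylinder_continuous_cst.
by under boolp.eq_fun do rewrite exprS; exact: cylinder_continuousM.
Qed.

Lemma exists_exp2_lt (r : R) : 0 < r -> exists n, 2 ^- n < r.
Proof.
move=> r0; exists (Num.truncn r^-1).+1.
rewrite invf_plt ?posrE ?exprn_gt0// (lt_le_trans (truncnS_gt _))//.
by rewrite -natrX ler_nat ltnW// ltn_expl.
Qed.

Lemma cantor_dist_le (x y : cantor_space) n :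
  (forall m, (m < n)%N -> x m = y m) -> cantor_dist R x y <= 2 ^- n.
Proof.
move=> xy; rewrite /cantor_dist; case: pselect => [xNy|_]; last first.
  by rewrite invr_ge0 exprn_ge0.
case: ex_minnP => m xym _; rewrite lef_pV2 ?posrE ?exprn_gt0//.
rewrite ler_weXn2l ?ler1n// leqNgt; apply/negP => /xy xym'.
by rewrite xym' eqxx in xym.
Qed.

Lemma cylinder_continuous_embedding d (j : 'I_d) (i : cantor_space -> F) :
  is_embedding N i -> cylinder_continuous (fun t => i (t j)).
Proof.
move=> [_ ic _] t e e0; have [r r0 rP] := ic (t j) e e0.
have [n nr] := exists_exp2_lt r0; exists n => t' tt'; apply: rP.
by apply: le_lt_trans nr; apply: cantor_dist_le => m mn; exact: tt'.
Qed.

(** Uniform continuity at scale 1 reduces the claim to the finitely many words of one length; the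
    sum of their norms stands in for a maximum. *)
Lemma embedding_bounded (i : cantor_space -> F) :
  is_embedding N i -> exists M : R, forall t, N (i t) <= M.
Proof.
move=> ei.
have [n nP] := cylinder_continuous_uniform
  (cylinder_continuous_embedding (ord0 : 'I_1) ei) ltr01.
exists (1 + \sum_(a : n.-tuple bool) N (i (pad a))) => t.
pose a := [tuple t m | m < n].
have ta : N (i t - i (pad a)) < 1.
  apply: (nP (fun=> t) (fun=> pad a)) => _ m mn.
  by rewrite /pad -(nth_mktuple (fun m : 'I_n => t m) false (Ordinal mn)).
have -> : i t = (i t - i (pad a)) + i (pad a) by ring.
apply: le_trans (normD normN _ _) _; apply: lerD; first exact: ltW.
rewrite (bigD1 a)//= lerDl sumr_ge0// => b _; exact: norm_ge0 normN _.
Qed.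

End uniform_continuity.

Section remez.
Context {R : realType} {F : fieldType} {N : F -> R} (normN : is_norm N).

(** Degrees are bounded in each variable separately, so that fixing the first variable leaves a
    polynomial of the same form. *)
Definition box_poly d k (c : d.-tuple 'I_k.+1 -> F) (y : 'I_d -> F) : F :=
  \sum_(m : d.-tuple 'I_k.+1) c m * \prod_(j < d) y j ^+ tnth m j.

Lemma box_polyS d k (c : d.+1.-tuple 'I_k.+1 -> F) (y : 'I_d.+1 -> F) :
  box_poly c y = box_poly (fun m => (\poly_(l < k.+1) c [tuple of inord l :: m]).[y ord0])
                   (fun j => y (lift ord0 j)).
Proof.
rewrite /box_poly (big_tuple_cons +%R) exchange_big/=; apply: eq_bigr => m _.
rewrite horner_poly mulr_suml; apply: eq_bigr => l _.
rewrite big_ord_recl tnth0 inord_val mulrA; congr (_ * _).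
by apply: eq_bigr => j _; rewrite tnthS.
Qed.

(* The cardinality hypothesis says that S has density at least 2^-e; passing to
   a slice costs one unit of e (slice_count). *)
Lemma remez d (i : 'I_d -> cantor_space -> F) (e : nat) :
  (forall j, spread_embedding N (i j)) ->
  exists2 D : R, 0 < D & forall k, exists L0, forall L, (L0 <= L)%N ->
    forall S : {set d.-tuple (L.-tuple bool)}, ((2 ^ L) ^ d <= 2 ^ e * #|S|)%N ->
    forall (c : d.-tuple 'I_k.+1 -> F) (B : R), 0 <= B ->
      (forall t, t \in S -> N (box_poly c (fun j => i j (pad (tnth t j)))) <= B) ->
      forall m, N (c m) <= B * D ^+ k.+1.
Proof.
elim: d i e => [|d IH] i e spi.
  exists 1 => // k; exists 0%N => L _ S hS c B B0 cB m.
  have [t tS] : exists t, t \in S.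
    apply/set0Pn; rewrite -card_gt0; move: hS.
    by rewrite expn0 muln_gt0 => /andP[].
  have := cB t tS; rewrite /box_poly (bigD1 m)//= big_ord0 mulr1.
  rewrite big1 ?addr0 ?expr1n ?mulr1// => m'.
  by rewrite [m]tuple0 [m']tuple0 eqxx.
have [M iM] := embedding_bounded normN (spi ord0).1.
have [D0 D00 D0P] := remez_line normN e.+1 (spi ord0) iM.
have [D1 D10 D1P] := IH (fun j => i (lift ord0 j)) e.+1 (fun j => spi _).
exists (D1 * D0); first exact: mulr_gt0.
move=> k; have [L0 L0P] := D0P k; have [L1 L1P] := D1P k.
exists (maxn L0 L1) => L; rewrite geq_max => /andP[LL0 LL1] S hS c B B0 cB m.
have cA : #|{: L.-tuple bool}| = (2 ^ L)%N by rewrite card_tuple card_bool.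
have := @slice_count _ d e S; rewrite cA => /(_ hS).
set T := finset _ => hT.
case/tupleP: m => m0 m; rewrite exprMn mulrA.
have D1n : 0 <= B * D1 ^+ k.+1 by rewrite mulr_ge0// exprn_ge0// ltW.
(* For each first word in [T] the induction hypothesis bounds the value of [g] by [B * D1 ^+ k.+1];
   the one-variable inequality then bounds the coefficients of [g], among them the required one. *)
pose g := \poly_(l < k.+1) c [tuple of inord l :: m].
have := L0P L LL0 T hT g _ (size_poly _ _) D1n _ m0.
rewrite coef_poly ltn_ord inord_val; apply => a; rewrite finset.inE => aT.
have := L1P L LL1 _ aT (fun m => (\poly_(l < k.+1) c [tuple of inord l :: m]).[i ord0 (pad a)])
   B B0.
apply => t; rewrite finset.inE => atS; have := cB _ atS.
rewrite box_polyS tnth0; congr (N (box_poly _ _) <= _).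
by apply/funext => j; rewrite tnthS.
Qed.

End remez.

(** * Homogeneous functions *)

Section homogeneous.
Context {F : fieldType} {n : nat}.
Implicit Types (f g : 'rV[F]_n -> F) (Phi Psi : 'rV[F]_n -> {poly F}).

Definition monomial_fun (e : {ffun 'I_n -> nat}) (x : 'rV[F]_n) : F :=
  \prod_j x 0 j ^+ e j.

(** The list may repeat monomials: sums are then concatenations, and products run over all pairs. *)
Definition homogeneous k f := exists s : seq (F * {ffun 'I_n -> nat}),
  (forall e, e \in s -> (\sum_j e.2 j)%N = k) /\
  forall x, f x = \sum_(e <- s) e.1 * monomial_fun e.2 x.

Lemma homogeneous0 k : homogeneous k (fun=> 0).
Proof. by exists [::]; split=> // x; rewrite big_nil. Qed.

Lemma homogeneous_cst c : homogeneous 0 (fun=> c).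
Proof.
exists [:: (c, [ffun=> 0%N])]; split=> [e|x].
  by rewrite inE => /eqP -> /=; apply: big1 => j _; rewrite ffunE.
rewrite big_seq1 /monomial_fun big1 ?mulr1// => j _.
by rewrite ffunE expr0.
Qed.

Lemma homogeneous_coord j : homogeneous 1 (fun x => x 0 j).
Proof.
exists [:: (1, [ffun i => (i == j) : nat])]; split=> [e|x].
  rewrite inE => /eqP -> /=; rewrite (bigD1 j)//= ffunE eqxx big1// => i ij.
  by rewrite ffunE (negbTE ij).
rewrite big_seq1 /monomial_fun (bigD1 j)//= ffunE eqxx expr1 mul1r.
by rewrite big1 ?mulr1// => i ij; rewrite ffunE (negbTE ij) expr0.
Qed.

Lemma homogeneousD k f g :
  homogeneous k f -> homogeneous k g -> homogeneous k (fun x => f x + g x).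
Proof.
move=> [s [sk fs]] [t [tk gt]]; exists (s ++ t); split=> [e|x].
  by rewrite mem_cat => /orP[/sk|/tk].
by rewrite big_cat /= fs gt.
Qed.

Lemma homogeneousM k l f g :
  homogeneous k f -> homogeneous l g -> homogeneous (k + l) (fun x => f x * g x).
Proof.
move=> [s [sk fs]] [t [tk gt]].
pose mul (e e' : F * {ffun 'I_n -> nat}) := (e.1 * e'.1, [ffun j => e.2 j + e'.2 j]%N).
exists [seq mul e e' | e <- s, e' <- t]; split=> [_ /allpairsP[[e e'] [es et ->]]|x] /=.
  rewrite -(sk e es) -(tk e' et) -big_split/=.
  by apply: eq_bigr => j _; rewrite ffunE.
rewrite big_allpairs_dep fs gt mulr_suml; apply: eq_bigr => e _.
rewrite mulr_sumr; apply: eq_bigr => e' _; rewrite mulrACA; congr (_ * _).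
rewrite /monomial_fun -big_split/=; apply: eq_bigr => j _.
by rewrite ffunE exprD.
Qed.

Lemma homogeneous_sum k I (r : seq I) (f : I -> 'rV[F]_n -> F) :
  (forall i, homogeneous k (f i)) ->
  homogeneous k (fun x => \sum_(i <- r) f i x).
Proof.
move=> fk; elim: r => [|i r IH].
  by under boolp.eq_fun do rewrite big_nil; exact: homogeneous0.
by under boolp.eq_fun do rewrite big_cons; exact: homogeneousD.
Qed.

(** The typical case is a polynomial in the products of the indeterminate with the coordinates of
    [x]. The size bound is uniform in [x], since it later controls the number of roots on every
    line. *)
Definition graded Phi :=
  (forall k, homogeneous k (fun x => (Phi x)`_k)) /\
  exists l, forall x, (size (Phi x) <= l)%N.

Lemma graded_cst c : graded (fun=> c%:P).
Proof.
split; last by exists 1%N => _; exact: size_polyC_leq1.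
move=> [|k]; under boolp.eq_fun do rewrite coefC /=.
  exact: homogeneous_cst.
exact: homogeneous0.
Qed.

Lemma graded_line (u : 'rV[F]_n) j : graded (fun x => (u 0 j)%:P + x 0 j *: 'X).
Proof.
split; last first.
  exists 2%N => x; apply: leq_trans (size_polyD _ _) _.
  rewrite geq_max (leq_trans (size_polyC_leq1 _))//=.
  by apply: leq_trans (size_scale_leq _ _) _; rewrite size_polyX.
move=> [|[|k]]; under boolp.eq_fun do rewrite coefD coefC coefZ coefX /=.
- by under boolp.eq_fun do rewrite mulr0 addr0; exact: homogeneous_cst.
- by under boolp.eq_fun do rewrite mulr1 add0r; exact: homogeneous_coord.
- by under boolp.eq_fun do rewrite mulr0 add0r; exact: homogeneous0.
Qed.

Lemma gradedD Phi Psi : graded Phi -> graded Psi -> graded (fun x => Phi x + Psi x).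
Proof.
move=> [hP [l lP]] [hQ [m mQ]]; split=> [k|].
  by under boolp.eq_fun do rewrite coefD; exact: homogeneousD.
exists (maxn l m) => x; apply: leq_trans (size_polyD _ _) _.
by rewrite geq_max !leq_max lP mQ orbT.
Qed.

Lemma gradedM Phi Psi : graded Phi -> graded Psi -> graded (fun x => Phi x * Psi x).
Proof.
move=> [hP [l lP]] [hQ [m mQ]]; split=> [k|].
  under boolp.eq_fun do rewrite coefM.
  apply: homogeneous_sum => i; have ik : (i <= k)%N by rewrite -ltnS ltn_ord.
  by rewrite -[X in homogeneous X](subnKC ik); exact: homogeneousM.
exists (l + m)%N => x; apply: leq_trans (size_polyMleq _ _) _.
by rewrite (leq_trans (leq_pred _))// leq_add.
Qed.

Lemma graded_sum I (r : seq I) (f : I -> 'rV[F]_n -> {poly F}) :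
  (forall i, graded (f i)) -> graded (fun x => \sum_(i <- r) f i x).
Proof.
move=> fk; elim: r => [|i r IH].
  by under boolp.eq_fun do rewrite big_nil -polyC0; exact: graded_cst.
by under boolp.eq_fun do rewrite big_cons; exact: gradedD.
Qed.

Lemma gradedX Phi k : graded Phi -> graded (fun x => Phi x ^+ k).
Proof.
move=> gP; elim: k => [|k IH].
  by under boolp.eq_fun do rewrite expr0 -polyC1; exact: graded_cst.
by under boolp.eq_fun do rewrite exprS; exact: gradedM.
Qed.

Lemma graded_prod I (r : seq I) (f : I -> 'rV[F]_n -> {poly F}) :
  (forall i, graded (f i)) -> graded (fun x => \prod_(i <- r) f i x).
Proof.
move=> fk; elim: r => [|i r IH].
  by under boolp.eq_fun do rewrite big_nil -polyC1; exact: graded_cst.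
by under boolp.eq_fun do rewrite big_cons; exact: gradedM.
Qed.

Lemma homogeneous_geom_inv Phi k :
  graded Phi -> homogeneous k (fun x => geom_inv (Phi x) k).
Proof.
move=> gP; suff [] : graded (fun x => \sum_(j < k.+1) (1 - Phi x) ^+ j) by [].
apply: graded_sum => j; apply: gradedX.
under boolp.eq_fun do rewrite -mulN1r -polyC1 -polyCN.
by apply: gradedD; [|apply: gradedM => //]; exact: graded_cst.
Qed.

Lemma graded_line_poly (p : mpoly.mpoly n F) u : graded (line_poly p u).
Proof.
rewrite /line_poly /mpoly.mmap /mpoly.mmap1.
apply: graded_sum => m; apply: gradedM; first exact: graded_cst.
by apply: graded_prod => j; apply: gradedX; exact: graded_line.
Qed.

Lemma horner_line_poly (p : mpoly.mpoly n F) u x z :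
  (line_poly p u x).[z] = peval p (u + z *: x).
Proof.
rewrite /line_poly /peval mpoly.mevalE /mpoly.mmap /mpoly.mmap1 horner_sum.
apply: eq_bigr => m _; rewrite hornerM hornerC horner_prod; congr (_ * _).
apply: eq_bigr => j _; rewrite horner_exp !hornerE !mxE.
by rewrite mulrC.
Qed.

End homogeneous.

(** * Dehomogenization and bounds from coefficients *)

Section dehomogenization.
Context {F : fieldType} {d : nat}.

(** As the total degree is [k], the other exponents determine the first one. The clause on nonzero
    coefficients makes the truncated subtraction in the exponent a true one. *)
Lemma homogeneous_box k (f : 'rV[F]_d.+1 -> F) : homogeneous k f ->
  exists c : d.-tuple 'I_k.+1 -> F,
    (forall m, c m != 0 -> (\sum_j tnth m j <= k)%N) /\
    forall x, f x = \sum_m c m * (x 0 ord0 ^+ (k - \sum_j tnth m j)%N *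
                      \prod_(j < d) x 0 (lift ord0 j) ^+ tnth m j).
Proof.
move=> [s [sk fs]].
pose mon (e : F * {ffun 'I_d.+1 -> nat}) : d.-tuple 'I_k.+1 :=
  [tuple inord (e.2 (lift ord0 j)) | j < d].
have monE e j : e \in s -> tnth (mon e) j = e.2 (lift ord0 j) :> nat.
  move=> es; rewrite tnth_mktuple inordK// ltnS -(sk e es).
  by rewrite (bigD1 (lift ord0 j))//= leq_addr.
have sum_mon e : e \in s -> (e.2 ord0 + \sum_j tnth (mon e) j)%N = k.
  move=> es; rewrite -[RHS](sk e es) big_ord_recl; congr addn.
  by apply: eq_bigr => j _; rewrite monE.
exists (fun m => \sum_(e <- s | mon e == m) e.1); split=> [m|x].
  move=> cm0; have [e es /eqP <-] : exists2 e, e \in s & mon e == m.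
    apply/hasP; apply: contraNT cm0 => /hasPn H.
    by rewrite big_seq_cond big1// => e /andP[/H/negbTE ->].
  by rewrite -[leqRHS](sum_mon e es) leq_addl.
rewrite fs; under [RHS]eq_bigr do rewrite mulr_suml.
rewrite (exchange_big_dep xpredT)//= big_seq [RHS]big_seq.
apply: eq_bigr => e es; rewrite (big_pred1 (mon e)) => [|m]; last exact: eq_sym.
congr (_ * _); rewrite /monomial_fun big_ord_recl; congr (_ * _).
  by rewrite -[X in (X - _)%N](sum_mon e es) addnK.
by apply: eq_bigr => j _; rewrite monE.
Qed.

End dehomogenization.

Section homogeneous_bound.
Context {R : realType} {F : fieldType} {N : F -> R} (normN : is_norm N) {d : nat}.
Context {k : nat} {f : 'rV[F]_d.+1 -> F} {c : d.-tuple 'I_k.+1 -> F}.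
Context (cdeg : forall m, c m != 0 -> (\sum_j tnth m j <= k)%N).
Context (fE : forall x, f x = \sum_m c m * (x 0 ord0 ^+ (k - \sum_j tnth m j)%N *
                      \prod_(j < d) x 0 (lift ord0 j) ^+ tnth m j)).

Lemma homogeneous_dehom (x : 'rV[F]_d.+1) : x 0 ord0 != 0 ->
  f x = x 0 ord0 ^+ k * box_poly c (fun j => x 0 (lift ord0 j) / x 0 ord0).
Proof.
move=> x0; rewrite fE /box_poly mulr_sumr; apply: eq_bigr => m _.
have [->|cm0] := eqVneq (c m) 0; first by rewrite !mul0r mulr0.
rewrite [RHS]mulrCA; congr (_ * _).
under [in RHS]eq_bigr do rewrite expr_div_n.
rewrite prodf_div prodrXr expfB_cond; last by rewrite (negbTE x0) add0n cdeg.
by rewrite mulrAC mulrA.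
Qed.

Lemma norm_le_max_norm (x : 'rV[F]_d.+1) j : N (x 0 j) <= max_norm N x.
Proof. by rewrite /max_norm (bigD1 j)//= le_max lexx. Qed.

Lemma homogeneous_bound (K : R) x : 0 <= K -> (forall m, N (c m) <= K) ->
  N (f x) <= (k.+1 ^ d)%:R * (K * max_norm N x ^+ k).
Proof.
move=> K0 cK; have mx0 : 0 <= max_norm N x.
  by apply: le_trans (norm_le_max_norm x ord0); exact: norm_ge0 normN _.
rewrite fE; apply: le_trans (ler_normf_sum normN _ _ _) _.
apply: (@le_trans _ _ (\sum_(m : d.-tuple 'I_k.+1) K * max_norm N x ^+ k)).
  apply: ler_sum => m _; rewrite (normM normN).
  have [->|cm0] := eqVneq (c m) 0.
    by rewrite (normf0 normN) mul0r mulr_ge0// exprn_ge0.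
  apply: ler_pM; rewrite ?(norm_ge0 normN)//.
  rewrite (normM normN) (normfX normN) (normf_prod normN).
  rewrite -[X in _ <= _ ^+ X](subnK (cdeg cm0)) exprD.
  apply: ler_pM; rewrite ?exprn_ge0 ?prodr_ge0 ?(norm_ge0 normN)//.
  - by move=> j _; exact: norm_ge0 normN _.
  - by apply: lerXn2r; rewrite ?nnegrE ?(norm_ge0 normN)// norm_le_max_norm.
  - rewrite -prodrXr; apply: ler_prod => j _; rewrite (normfX normN).
    rewrite exprn_ge0 ?(norm_ge0 normN)//=.
    by apply: lerXn2r; rewrite ?nnegrE ?(norm_ge0 normN)// norm_le_max_norm.
by rewrite sumr_const card_tuple card_ord mulr_natl.
Qed.

End homogeneous_bound.

(** * Spread sets *)

Local Open Scope classical_set_scope.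

Section spread_sets.
Context {R : realType} {F : fieldType} {N : F -> R} (normN : is_norm N).

Definition word_box d L (s : d.-tuple (L.-tuple bool)) : set (d.-tuple cantor_borel) :=
  box (fun j => tnth s j).

Definition box_trace d L (A : set (d.-tuple cantor_borel)) :
    {set d.-tuple (L.-tuple bool)} :=
  finset (fun s : d.-tuple (L.-tuple bool) => `[< exists2 t, A t & word_box s t >]).

Lemma measure_boxes_le d L (r : seq (d.-tuple (L.-tuple bool))) :
  (@cantor_power R d (\big[setU/set0]_(s <- r) word_box s) <=
   ((size r)%:R / ((2 ^ L) ^ d)%:R)%:E)%E.
Proof.
elim: r => [|s r IH]; first by rewrite big_nil measure0 mul0r.
rewrite big_cons; apply: le_trans (measureU2 _ _ _) _.
- exact: measurable_box.
- by apply: bigsetU_measurable => t _; exact: measurable_box.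
have muE : @cantor_power R d (word_box s) = (1 / ((2 ^ L) ^ d)%:R)%:E.
  rewrite cantor_powerE; under eq_bigr do rewrite size_tuple.
  by rewrite prodr_const card_ord mul1r !natrX exprVn.
by rewrite -natr1 addrC mulrDl EFinD -muE; apply: leeD => //; exact: lexx.
Qed.

(** The boxes of the trace cover [A] and have equal measure, so monotonicity of the outer measure
    forces many of them; one [e] serves all lengths [L]. *)
Lemma card_box_trace d (A : set (d.-tuple cantor_borel)) :
  (0 < (@cantor_power R d)^*%mu A)%E ->
  exists e, forall L, ((2 ^ L) ^ d <= 2 ^ e * #|box_trace L A|)%N.
Proof.
move=> A0; have [e eA] : exists e, ((2 ^- e)%:E <= (@cantor_power R d)^*%mu A)%E.
  move: A0; case: (mu_ext _ _) => [r| |] //; last by exists 0%N; rewrite leey.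
  by rewrite lte_fin => /exists_exp2_lt[e /ltW er]; exists e; rewrite lee_fin.
exists e => L; pose r := enum (box_trace L A).
have mU : measurable (\big[setU/set0]_(s <- r) word_box s).
  by apply: bigsetU_measurable => t _; exact: measurable_box.
have AU : A `<=` \big[setU/set0]_(s <- r) word_box s.
  move=> t At; rewrite -bigcup_seq.
  pose s : d.-tuple (L.-tuple bool) := [tuple [tuple tnth t j m | m < L] | j < d].
  have ts : word_box s t.
    move=> j m; rewrite size_tuple => mL.
    by rewrite tnth_mktuple (nth_mktuple (fun m : 'I_L => tnth t j m) false (Ordinal mL)).
  exists s => //=; rewrite mem_enum finset.inE; apply/asboolP.
  by exists t.
have := le_trans eA (le_mu_ext (@cantor_power R d) AU).
rewrite measurable_mu_extE// => /le_trans/(_ (measure_boxes_le r)).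
rewrite lee_fin -cardE ler_pdivlMr ?ltr0n ?expn_gt0// mulrC ler_pdivrMr ?exprn_gt0//.
by rewrite -natrX -natrM ler_nat mulnC.
Qed.

Lemma affine_spread_nonempty d (Y : set 'rV[F]_d) :
  affine_spread N Y -> exists y, Y y.
Proof.
move=> [i [_ mu0]]; apply: contrapT => Y0; move: mu0.
rewrite (_ : [set t | _] = set0) ?mu_ext0 ?ltxx//.
by apply/seteqP; split=> // t /= Yt; apply: Y0; eexists; exact: Yt.
Qed.

(** Each box of the trace contains a tuple of branches mapped into [Y]. For large [L], replacing it
    by the padded words changes the value by less than [B], which costs the factor 2 and reduces the
    claim to [remez]. *)
Lemma affine_spread_coef_bound d (Y : set 'rV[F]_d) : affine_spread N Y ->
  exists2 D : R, 0 < D & forall k (c : d.-tuple 'I_k.+1 -> F) (B : R), 0 < B ->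
    (forall y, Y y -> N (box_poly c (fun j => y 0 j)) <= B) ->
    forall m, N (c m) <= 2 * B * D ^+ k.+1.
Proof.
move=> [i [spi muY]]; set A := [set t | _] in muY.
have [e eP] := card_box_trace muY.
have [D D0 DP] := remez normN e spi; exists D => // k c B B0 cB m.
have [L0 L0P] := DP k.
pose g (t : 'I_d -> cantor_space) := box_poly c (fun j => i j (t j)).
have gc : cylinder_continuous (N := N) g.
  apply: (cylinder_continuous_sum normN) => {}m.
  apply: (cylinder_continuousM normN); first exact: cylinder_continuous_cst.
  apply: (cylinder_continuous_prod normN) => j.
  apply: (cylinder_continuousX normN); apply: cylinder_continuous_embedding.
  exact: (spi j).1.
have [n nP] := cylinder_continuous_uniform normN gc B0.
have B20 : 0 <= 2 * B by rewrite mulr_ge0// ltW.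
apply: (L0P (maxn L0 n) _ (box_trace _ A)) => //; first by rewrite leq_maxl.
move=> s; rewrite finset.inE => /asboolP[t At ts].
pose t' : 'I_d -> cantor_space := fun j => tnth t j.
pose s' : 'I_d -> cantor_space := fun j => pad (tnth s j).
rewrite -/(g s').
have gs : N (g t' - g s') < B.
  apply: nP => j l ln; apply: ts; rewrite size_tuple.
  by rewrite (leq_trans ln)// leq_maxr.
have gt : N (g t') <= B.
  have := cB _ At; congr (N (box_poly _ _) <= _).
  by apply/funext => j; rewrite mxE.
have -> : g s' = - (g t' - g s') + g t' by ring.
apply: le_trans (normD normN _ _) _; rewrite (normfN normN) mulrDl mul1r.
by apply: lerD => //; exact: ltW.
Qed.

Definition large_first d (X : set 'rV[F]_d.+1) (m : nat) : set 'rV[F]_d.+1 :=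
  [set x | X x /\ 1 <= m.+1%:R * N (x 0 ord0)].

(** Dehomogenizing divides by powers of the first coordinate, whose norm must therefore be bounded
    below. The sets [A m] cover the preimage for [X], so by countable subadditivity one of them has
    positive outer measure. *)
Lemma spread_large_first d (X : set 'rV[F]_d.+1) :
  spread N X -> exists m, spread N (large_first X m).
Proof.
move=> [i [spi muX]].
pose A m := [set t : d.-tuple cantor_borel |
  dehomogenize (large_first X m) (\row_j i j (tnth t j))].
suff [m mP] : exists m, (0 < (@cantor_power R d)^*%mu (A m))%E.
  by exists m, i.
apply: contrapT => H; have A0 m : (@cantor_power R d)^*%mu (A m) = 0%E.
  apply/eqP; rewrite eq_le; apply/andP; split.
    by rewrite leNgt; apply/negP => ?; apply: H; exists m.
  by apply: mu_ext_ge0 => ?; exact: measure_ge0.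
move: muX; rewrite ltNge => /negP; apply.
apply: (@le_trans _ _ ((@cantor_power R d)^*%mu (\bigcup_m A m))).
  apply: le_mu_ext => t /= [x [Xx /eqP x0] xt].
  have nx0 := normf_gt0 normN x0.
  exists (Num.truncn (N (x 0 ord0))^-1) => //; exists x => //=; split; last exact/eqP.
  split=> //; rewrite -ler_pdivrMr// mul1r; apply: ltW; exact: truncnS_gt.
apply: le_trans (mu_ext_sigma_subadditive _ _) _; first by move=> ?; exact: measure_ge0.
by rewrite eseries0.
Qed.

End spread_sets.

(** * Distance to the zero set *)

Section reciprocal_bounds.
Context {R : realType} {F : fieldType} {N : F -> R} (normN : is_norm N).

(** If [h'] belongs to the product without [b], then [h k.+1 = h' k.+1 + b * h k], and each term is
    at most half of the claimed bound. *)
Lemma reciprocal_prod_bound (q : R) (bs : seq F) (h : nat -> F) : 0 <= q ->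
  (forall b, b \in bs -> N b <= q) ->
  reciprocal (\prod_(b <- bs) (1 - b *: 'X)) h ->
  forall k, N (h k) <= 2 ^+ (size bs + k) * q ^+ k.
Proof.
move=> q0; elim: bs h => [|b bs IH] h bq.
  rewrite big_nil => Ah k.
  have := Ah k; rewrite big_ord_recl big1 => [|i _]; last by rewrite coef1 mul0r.
  rewrite coef1 mul1r subn0 addr0 => ->.
  case: k => [|k]; last by rewrite (normf0 normN) mulr_ge0// exprn_ge0.
  by rewrite (normf1 normN) !expr0 mulr1.
rewrite big_cons => /reciprocal_factor /IH {}IH k.
have {}IH := IH (fun c cbs => bq c (mem_behead (cbs : c \in behead (b :: bs)))).
elim: k => [|k IHk] /=.
  have := IH 0%N; rewrite mulr0 subr0 => /le_trans; apply.
  by rewrite ler_wpM2r ?exprn_ge0// ler_weXn2l ?ler1n// leq_add2r.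
have -> : h k.+1 = (h k.+1 - b * h k) + b * h k by ring.
apply: le_trans (normD normN _ _) _; rewrite (normM normN).
apply: (@le_trans _ _ (2 ^+ (size bs + k.+1) * q ^+ k.+1 +
                       q * (2 ^+ ((size bs).+1 + k) * q ^+ k))).
  apply: lerD; first exact: IH k.+1.
  by apply: ler_pM; rewrite ?(norm_ge0 normN) ?bq// inE eqxx.
by rewrite addSnnS addSn addnS !exprS; lra.
Qed.

(** The product of [A] and the series is [1 / (1 - 'X)], all of whose coefficients are 1. *)
Lemma reciprocal_root1 (A : {poly F}) (h : nat -> F) :
  reciprocal ((1 - 'X) * A) h ->
  forall k, \sum_(i < k.+1) A`_i * h (k - i)%N = 1.
Proof.
move/reciprocalP => Ah k.
have main K l : (l < K)%N -> (A * \poly_(i < K) h i)`_l = 1.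
  elim: l => [|l IH] lK; have := Ah K _ lK; rewrite -mulrA mulrBl mul1r coefB coefXM /=.
    by rewrite subr0.
  by rewrite IH ?(ltnW lK)// => /eqP; rewrite subr_eq0 => /eqP.
rewrite -[RHS](main k.+1 k (ltnSn k)) coefM; apply: eq_bigr => i _.
by rewrite coef_poly ltnS leq_subr.
Qed.

(** If 1 were a root, the cofactor of [1 - 'X] convolved with [h] would be constantly 1, whereas a
    finite sequence convolved with a geometrically decaying one tends to 0. *)
Lemma reciprocal_no_root1 (A : {poly F}) (h : nat -> F) (K : R) :
  reciprocal A h -> (forall k, N (h k) <= K * 2 ^- k) -> A.[1] != 0.
Proof.
move=> Ah hK; apply/negP => /factor_theorem[A1 A1E].
have {}Ah : reciprocal ((1 - 'X) * (- A1)) h.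
  by rewrite mulrN -mulNr opprB mulrC -polyC1 -A1E.
have sum1 := reciprocal_root1 Ah.
have K0 : 0 <= K by have := hK 0%N; rewrite invr1 mulr1; apply: le_trans; exact: norm_ge0 normN _.
(* The weight [2 ^+ i] compensates for the index shift in [2 ^- (k - i)]. *)
set s := size (- A1) in sum1 *; pose W := \sum_(i < s) N (- A1)`_i * 2 ^+ i.
have W0 : 0 <= W by apply: sumr_ge0 => i _; rewrite mulr_ge0 ?(norm_ge0 normN)// exprn_ge0.
have KW0 : 0 < K * W + 1 by rewrite ltr_wpDl// mulr_ge0.
have [n nP] : exists n, 2 ^- n < (K * W + 1)^-1 by apply: exists_exp2_lt; rewrite invr_gt0.
pose k := (s + n)%N.
have : 1 <= K * W * 2 ^- k.
  rewrite -[leLHS](normf1 normN) -[X in N X <= _](sum1 k); apply: le_trans (ler_normf_sum normN _ _ _) _.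
  rewrite -(big_mkord xpredT (fun i => N ((- A1)`_i * h (k - i)%N))).
  rewrite (@big_cat_nat _ _ _ s)//=; last by rewrite /k -addnS leq_addr.
  rewrite [X in _ + X]big_nat [X in _ + X]big1 => [|i /andP[si _]]; last first.
    by rewrite nth_default// mul0r (normf0 normN).
  rewrite addr0 big_mkord -mulrA mulrCA mulr_suml; apply: ler_sum => i _.
  rewrite (normM normN) -mulrA ler_wpM2l ?(norm_ge0 normN)//.
  have ik : (i <= k)%N by rewrite (leq_trans (ltnW (ltn_ord i)))// leq_addr.
  apply: le_trans (hK _) _; rewrite mulrCA ler_wpM2l//.
  by rewrite -[X in _ <= _ * 2 ^- X](subnK ik) exprD invfM mulrCA divff ?mulr1// expf_neq0.
apply/negP; rewrite -ltNge.
have kn : 2 ^- k <= 2 ^- n :> R.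
  by rewrite lef_pV2 ?posrE ?exprn_gt0// ler_weXn2l ?ler1n// leq_addl.
have : 2 ^- k < (K * W + 1)^-1 by apply: le_lt_trans nP.
rewrite -[X in _ < X]mul1r ltr_pdivlMr// => h1.
by apply: le_lt_trans h1; rewrite mulrC ler_wpM2l ?invr_ge0 ?exprn_ge0// lerDl.
Qed.

(** Since [q.[0] != 0], the scalar [c] and all roots are nonzero, and [- a] can be divided out of
    each factor ['X - a%:P]. *)
Lemma splits_reciprocal_roots (q : {poly F}) : splits q -> q.[0] != 0 ->
  exists bs : seq F, [/\ (size bs <= size q)%N,
    (q.[0])^-1 *: q = \prod_(b <- bs) (1 - b *: 'X) &
    forall b, b \in bs -> b != 0 /\ root q b^-1].
Proof.
move=> [c [rs ->]]; set P := \prod_(a <- rs) _ => cP0.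
have [c0 P0] : c != 0 /\ P.[0] != 0.
  by apply/andP; rewrite -negb_or -mulf_eq0 -hornerZ.
have rs0 a : a \in rs -> a != 0.
  move=> ars; apply: contraNneq P0 => a0; rewrite -/(root P 0) root_prod_XsubC.
  by rewrite -a0.
exists [seq a^-1 | a <- rs]; split.
- by rewrite size_map size_scale// size_prod_XsubC.
- rewrite hornerZ scalerA invfM mulrAC mulVf// mul1r big_map.
  rewrite /P horner_prod -prodfV -scaler_prod.
  rewrite big_seq [RHS]big_seq; apply: eq_bigr => a ars.
  rewrite hornerXsubC sub0r invrN scalerBr scaleNr scaleNr -opprD opprB.
  by rewrite -[a%:P]alg_polyC scalerA mulVf ?rs0// scale1r.
- move=> _ /mapP[a ars ->]; rewrite invr_eq0 invrK rs0//; split=> //.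
  by rewrite rootZ// root_prod_XsubC.
Qed.

End reciprocal_bounds.

(** * Lower bound for the distance to a single zero *)

Section main_estimate.
Context {R : realType} {F : fieldType} {N : F -> R} (normN : is_norm N) {d : nat}.
Implicit Types (X : set 'rV[F]_d.+1) (p : mpoly.mpoly d.+1 F) (u w x : 'rV[F]_d.+1).

Lemma zero_distance_lower_bound X : spread N X -> exists2 C : R, 0 < C &
  forall p, hyperbolic X p -> forall u w rho, 0 < rho ->
    (forall x, X x -> forall z, N z <= rho -> peval p (u + z *: x) <> 0) ->
    peval p w = 0 -> C * rho < max_norm N (u - w).
Proof.
move=> /(spread_large_first normN)[m spX].
have [D D0 DP] := affine_spread_coef_bound normN spX.
pose M : R := m.+1%:R; have M0 : 0 < M by rewrite ltr0n.
(* [E] collects what enters to the power [k]: [2 ^+ d] from the number of monomials, 2 from the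
   bound on [h], [M] from the first coordinate, [D] from the coefficient bound. The choice of [C]
   below makes the ratio at [w - u] at most 1/2. *)
pose E := 2 ^+ d * 2 * M * D.
have E0 : 0 < E by rewrite !mulr_gt0// exprn_gt0.
exists (2 * E)^-1; first by rewrite invr_gt0 mulr_gt0.
move=> p hp u w rho rho0 pX pw; rewrite ltNge; apply/negP => wC.
have pu0 : peval p u != 0.
  have [_ [x [[Xx _] _] _]] := affine_spread_nonempty spX.
  apply/eqP; have := pX x Xx 0; rewrite scale0r addr0 (normf0 normN) => /(_ (ltW rho0)).
  by [].
pose A x := (peval p u)^-1 *: line_poly p u x.
have gA : graded A.
  rewrite /A; under boolp.eq_fun do rewrite -mul_polyC.
  by apply: gradedM; [exact: graded_cst|exact: graded_line_poly].
have line0 x : (line_poly p u x).[0] = peval p u.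
  by rewrite horner_line_poly scale0r addr0.
have A0 x : (A x)`_0 = 1.
  by rewrite -horner_coef0 hornerZ line0 mulVf.
(* This [n] depends on [p], but it only enters through a factor independent of [k]; hence [C] does
   not depend on [p]. *)
have [n nA] : exists n, forall x, (size (line_poly p u x) <= n)%N.
  exact: (graded_line_poly p u).2.
pose h x := geom_inv (A x).
have Ah x : reciprocal (A x) (h x) by exact: reciprocal_geom_inv.
have hX x k : X x -> N (h x k) <= 2 ^+ (n + k) * rho^-1 ^+ k.
  move=> Xx; have := @splits_reciprocal_roots _ (line_poly p u x) (hp u x Xx).
  rewrite line0 => /(_ pu0)[bs [sbs bsE bsr]].
  apply: le_trans (reciprocal_prod_bound normN (q := rho^-1) _ _ _ k) _.
  - by rewrite invr_ge0 ltW.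
  (* The inverse of [b] is a zero on the line, so its norm exceeds [rho]. *)
  - move=> b /bsr[b0 /rootP]; rewrite horner_line_poly => rb.
    rewrite leNgt; apply/negP => bq; apply: (pX x Xx b^-1) => //.
    rewrite (normfV normN) -[leRHS]invrK lef_pV2 ?posrE ?invr_gt0 ?(ltW bq)//.
    exact: normf_gt0.
  - by rewrite -bsE; exact: Ah.
  by rewrite ler_wpM2r ?exprn_ge0 ?invr_ge0 ?(ltW rho0)// ler_weXn2l ?ler1n//
    leq_add2r (leq_trans sbs).
have hb x k : N (h x k) <= 2 ^+ n.+1 * D * (E / rho * max_norm N x) ^+ k.
  have [c [cdeg cE]] := homogeneous_box (homogeneous_geom_inv k gA).
  (* On [large_first X m] the inverse of the first coordinate has norm at most [M], so [B] bounds
     the dehomogenized [h]. *)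
  pose B := 2 ^+ (n + k) * rho^-1 ^+ k * M ^+ k.
  have B0 : 0 < B by rewrite !mulr_gt0 ?exprn_gt0 ?invr_gt0.
  have cB : forall mu, N (c mu) <= 2 * B * D ^+ k.+1.
    apply: DP => // _ [y [[Xy yM] /eqP y0] <-].
    have ny0 := normf_gt0 normN y0.
    have /(congr1 N) := homogeneous_dehom cdeg cE y0.
    rewrite (normM normN) (normfX normN) => hy.
    under boolp.eq_fun do rewrite mxE.
    have yk0 : 0 < N (y 0 ord0) ^+ k by rewrite exprn_gt0.
    rewrite -(ler_pM2l yk0) -hy; apply: le_trans (hX y k Xy) _.
    rewrite /B mulrCA ler_peMr ?mulr_ge0 ?exprn_ge0 ?invr_ge0 ?(ltW rho0)//.
    by rewrite -exprMn exprn_ege1// mulrC.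
  have BD0 : 0 <= 2 * B * D ^+ k.+1 := ltW (mulr_gt0 (mulr_gt0 (ltr0Sn R 1) B0) (exprn_gt0 _ D0)).
  apply: le_trans (homogeneous_bound normN cdeg cE x BD0 cB) _.
  have kd : (k.+1 ^ d)%:R <= (2 ^+ d) ^+ k :> R.
    rewrite -exprM mulnC exprM natrX; apply: lerXn2r; rewrite ?nnegrE ?exprn_ge0//.
    by rewrite -natrX ler_nat ltn_expl.
  have mx0 : 0 <= max_norm N x by apply: le_trans (norm_le_max_norm x ord0); exact: norm_ge0 normN _.
  apply: le_trans (ler_wpM2r _ kd) _; first by rewrite mulr_ge0// exprn_ge0.
  rewrite le_eqVlt; apply/orP; left; apply/eqP.
  rewrite /B /E !exprMn exprD !exprS exprVn.
  ring.
have E2 : 2 * E * (2 * E)^-1 = 1 by rewrite divff// gt_eqF// mulr_gt0.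
have hw k : N (h (w - u) k) <= 2 ^+ n.+1 * D * 2 ^- k.
  apply: le_trans (hb _ _) _; rewrite ler_wpM2l ?mulr_ge0 ?exprn_ge0 ?(ltW D0)//.
  have mw : max_norm N (w - u) = max_norm N (u - w).
    by rewrite /max_norm; apply: eq_bigr => j _; rewrite !mxE -(normfN normN) opprB.
  have mw0 : 0 <= max_norm N (w - u).
    by apply: le_trans (norm_le_max_norm _ ord0); exact: norm_ge0 normN _.
  rewrite -exprVn lerXn2r ?nnegrE ?invr_ge0//.
    by rewrite mulr_ge0// divr_ge0 ?ltW.
  rewrite mw mulrAC ler_pdivrMr// -(@ler_pM2l _ E^-1) ?invr_gt0//.
  rewrite mulrA mulVf ?gt_eqF// mul1r; apply: le_trans wC _.
  by rewrite invfM mulrA [E^-1 * _]mulrC.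
(* At parameter 1 the line from [u] in direction [w - u] meets the zero [w]. *)
have := reciprocal_no_root1 normN (Ah (w - u)) hw; rewrite hornerZ horner_line_poly.
by rewrite scale1r addrC subrK pw mulr0 eqxx.
Qed.

End main_estimate.

Theorem corollary4p3 (R : realType) (F : fieldType) (N : F -> R)
  (normN : is_norm N) (completeN : is_complete N)
  (d : nat) (X : set 'rV[F]_d.+1) (spreadX : spread N X) :
  exists2 C : R, 0 < C &
    forall p : mpoly.mpoly d.+1 F, hyperbolic X p ->
    forall u : 'rV[F]_d.+1,
      (C%:E * ereal_inf [set free_radius N p u x | x in X]
         <= dist_set N u (zero_set p))%E.
Proof.
have [C C0 CP] := zero_distance_lower_bound normN spreadX.
exists C => // p hp u; apply: le_ereal_inf_tmp => _ [w pw <-].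
rewrite leNgt -lte_pdivrMl// -EFinM; apply/negP.
set I := ereal_inf _; set del := max_norm N (u - w) => delI.
(* If [I] is finite, [rho] is a midpoint; if it is infinite, any larger real will do. *)
have [rho rdel rI] : exists2 rho, C^-1 * del < rho & (rho%:E < I)%E.
  move: delI; case: I => [r| |//].
    by rewrite lte_fin => /midf_lt[h1 h2]; exists ((C^-1 * del + r) / 2).
  by move=> _; exists (C^-1 * del + 1); rewrite ?ltry// ltrDl.
have del0 : 0 <= del.
  by apply: le_trans (norm_le_max_norm (u - w) ord0); exact: norm_ge0 normN _.
have rho0 : 0 < rho by apply: le_lt_trans rdel; rewrite mulr_ge0// invr_ge0 ltW.
have := CP p hp u w rho rho0 _ pw; rewrite ltNge => /(_ _)/negP; apply.
  move=> x Xx z zrho.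
  have : (rho%:E < free_radius N p u x)%E.
    by apply: lt_le_trans rI _; apply: ereal_inf_lbound; exists x.
  (* As [rho] is positive, it is not below the 0 in [free_radius]; so the supremum exceeds it, and
     some admissible radius does. *)
  rewrite lt_max lte_fin (lt_gtF rho0) /= => /ereal_sup_gt[_ [r [r0 rP] <-]].
  by rewrite lte_fin => /ltW rr; apply: rP; exact: le_trans zrho rr.
by rewrite -ler_pdivrMl// ltW.
Qed.
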